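(* Let $m\geq 1$ be an integer, let $\alpha_0^{(1)},\ldots,\alpha_0^{(m)}$ be irrational real numbers for which the Jacobi--Perron algorithm does not terminate, let $(a_n^{(i)})_{n=0}^\infty$, $i=1,\ldots,m$, be the sequences of partial quotients it produces, and let $(A_n^{(i)})_{n=0}^\infty$, $i=1,\ldots,m+1$, be the associated sequences of numerators ($i=1,\ldots,m$) and denominators ($i=m+1$) of the convergents. If all the sequences $(a_n^{(i)})_{n=0}^\infty$, $i=1,\ldots,m$, are periodic, then all the sequences $(A_n^{(i)})_{n=0}^\infty$, $i=1,\ldots,m+1$, are linear recurrence sequences.
   Context: Jacobi--Perron algorithm: given real numbers $\alpha_0^{(1)},\ldots,\alpha_0^{(m)}$, define for $n=0,1,2,\ldots$ $$a_n^{(i)}=[\alpha_n^{(i)}]\ (i=1,\ldots,m),\qquad \alpha_{n+1}^{(1)}=\frac{1}{\alpha_n^{(m)}-a_n^{(m)}},\qquad \alpha_{n+1}^{(i)}=\frac{\alpha_n^{(i-1)}-a_n^{(i-1)}}{\alpha_n^{(m)}-a_n^{(m)}}\ (i=2,\ldots,m),$$ where $[\cdot]$ is the integer part (floor). The integers $a_n^{(i)}$ are the partial quotients of the multidimensional continued fraction $[\{a_0^{(1)},a_1^{(1)},\ldots\},\ldots,\{a_0^{(m)},a_1^{(m)},\ldots\}]$ of $(\alpha_0^{(1)},\ldots,\alpha_0^{(m)})$. The algorithm does not terminate when $\alpha_n^{(m)}\neq a_n^{(m)}$ for all $n\geq 0$, so that all the sequences are infinite. Numerators and denominators of convergents: the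 convergents are $\left(A_n^{(1)}/A_n^{(m+1)},\ldots,A_n^{(m)}/A_n^{(m+1)}\right)$, $n\ge 0$, where the integers $A_n^{(i)}$ are defined by $$A_n^{(i)}=\sum_{j=1}^m a_n^{(j)}A_{n-j}^{(i)}+A_{n-m-1}^{(i)},\quad i=1,\ldots,m+1,\ n\geq 1,$$ with initial conditions $A_0^{(i)}=a_0^{(i)}$, $A_{-i}^{(i)}=1$, $A_{-j}^{(i)}=0$ for $i,j\in\{1,\ldots,m\}$, $j\neq i$, and $A_0^{(m+1)}=1$, $A_{-i}^{(m+1)}=0$ for $i=1,\ldots,m$. A sequence $(s_n)_{n=0}^\infty$ is called periodic if it is periodic from some index on (a pre-period is allowed): there are $N\geq 0$ and $q\geq 1$ with $s_{n+q}=s_n$ for all $n\geq N$. The pre-periods and periods of the $m$ sequences of partial quotients may differ. A linear recurrence sequence is a sequence $(s_n)_{n=0}^\infty$ satisfying a linear homogeneous recurrence with constant coefficients: there are $d\geq 1$ and constants $c_1,\ldots,c_d\in\mathbb C$ (possibly zero) with $s_n=c_1s_{n-1}+\cdots+c_ds_{n-d}$ for all $n\geq d$. *)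

(* Defs.v *)
From mathcomp Require Import all_boot all_order all_algebra.
From mathcomp Require Import classical_sets reals.
From mathcomp Require Import complex.

Set Implicit Arguments.
Unset Strict Implicit.
Unset Printing Implicit Defensive.

Import Order.TTheory GRing.Theory Num.Theory.
Local Open Scope ring_scope.

(* Upper indices are natural numbers starting at 1, as on paper: an m-tuple
   is a function on nat of which only the values at 1, ..., m are meaningful. *)

(* jp_alpha m alpha0 n i is alpha_n^(i). When the algorithm terminates (the
   denominator vanishes), the later values are junk, since 0^-1 = 0. *)
Fixpoint jp_alpha (R : realType) (m : nat) (alpha0 : nat -> R) (n i : nat) : R :=
  match n with
  | 0 => alpha0 i
  | n'.+1 =>
      let frac j := jp_alpha m alpha0 n' j
                    - (Num.floor (jp_alpha m alpha0 n' j))%:~R in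
      if i == 1%N then (frac m)^-1 else frac i.-1 / frac m
  end.

Definition jp_quotient (R : realType) (m : nat) (alpha0 : nat -> R)
  (n i : nat) : int := Num.floor (jp_alpha m alpha0 n i).

Definition jp_nonterminating (R : realType) (m : nat) (alpha0 : nat -> R) : Prop :=
  forall n, jp_alpha m alpha0 n m <> (jp_quotient m alpha0 n m)%:~R.

(* A i n is A_n^(i); the lower index is an integer, and only the values at
   1 <= i <= m + 1 and n >= -m are meaningful (they are determined by a). *)
Record jp_convergents (m : nat) (a : nat -> nat -> int) (A : nat -> int -> int)
    : Prop := JPConvergents {
  jp_conv_rec : forall i n : nat, (1 <= i <= m.+1)%N -> (1 <= n)%N ->
    A i n%:Z = \sum_(1 <= j < m.+1) a n j * A i (n%:Z - j%:Z)
               + A i (n%:Z - m%:Z - 1);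
  jp_conv_num0 : forall i : nat, (1 <= i <= m)%N -> A i 0 = a 0%N i;
  jp_conv_num_diag : forall i : nat, (1 <= i <= m)%N -> A i (- i%:Z) = 1;
  jp_conv_num_off : forall i j : nat, (1 <= i <= m)%N -> (1 <= j <= m)%N ->
    j <> i -> A i (- j%:Z) = 0;
  jp_conv_den0 : A m.+1 0 = 1;
  jp_conv_den_neg : forall i : nat, (1 <= i <= m)%N -> A m.+1 (- i%:Z) = 0
}.

Definition eventually_periodic (T : Type) (s : nat -> T) : Prop :=
  exists N q : nat, (1 <= q)%N /\ forall n, (N <= n)%N -> s (n + q)%N = s n.

Definition linear_recurrence (K : pzRingType) (s : nat -> K) : Prop :=
  exists (d : nat) (c : nat -> K), (1 <= d)%N /\
    forall n, (d <= n)%N -> s n = \sum_(1 <= j < d.+1) c j * s (n - j)%N.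

(* Main.v *)
Require Import Defs.
From mathcomp Require Import all_boot all_order all_algebra.
From mathcomp Require Import classical_sets reals.
From mathcomp Require Import complex.
From mathcomp Require Import zify.

Import Order.TTheory GRing.Theory Num.Theory.
Local Open Scope ring_scope.

(** Fix an upper index [i].  For large [n], the sequence [s n = A_n^(i)]
    satisfies a linear recurrence of order [p = m + 1] whose coefficients are
    the partial quotients, and these have a common period [q]
    ([common_period]).

    Solutions of a linear recurrence with varying coefficients form a vector
    space, and [p] consecutive values determine all later ones
    ([recurrence_window_eq0]).  By periodicity of the coefficients, the shift
    by [q] maps solutions to solutions, once [n] is past the pre-periods.  The [p + 1] solutions
    [n |-> s (n + k q)], [0 <= k <= p], therefore live in a space of dimension
    at most [p] and satisfy a nontrivial linear relation
    [\sum_k u_k s (n + k q) = 0] with constant coefficients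
    ([periodic_coefficients_relation]).  Solving it for the term with the
    largest index whose coefficient is nonzero gives the desired constant
    coefficient recurrence ([linear_recurrence_of_relation]). *)

Lemma eventually_periodic_mul (T : Type) (s : nat -> T) (N q : nat) :
  (forall n, (N <= n)%N -> s (n + q)%N = s n) ->
  forall k n, (N <= n)%N -> s (n + k * q)%N = s n.
Proof.
move=> per; elim=> [|k IHk] n len; first by rewrite mul0n addn0.
by rewrite mulSn addnA IHk ?per // (leq_trans len) ?leq_addr.
Qed.

Lemma common_period (T : Type) (a : nat -> nat -> T) (m : nat) :
  (forall j, (1 <= j <= m)%N -> eventually_periodic (fun n => a n j)) ->
  exists N q : nat, (1 <= q)%N /\
    forall n j, (N <= n)%N -> (1 <= j <= m)%N -> a (n + q)%N j = a n j.
Proof.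
elim: m => [|m IHm] per.
  by exists 0%N, 1%N; split=> // n j _; lia.
have [j hj|N [q [q_gt0 perN]]] := IHm; first by apply: per; lia.
have [|N' [q' [q'_gt0 perN']]] := per m.+1; first by lia.
exists (maxn N N'), (q * q')%N; split=> [|n j]; first by rewrite muln_gt0 q_gt0.
rewrite geq_max => /andP[leNn leN'n] hj.
have [->|neq_j] := eqVneq j m.+1.
  by rewrite (@eventually_periodic_mul _ (fun n => a n m.+1) N').
rewrite mulnC (@eventually_periodic_mul _ (fun n => a n j) N) //.
by move=> k leNk; apply: perN => //; lia.
Qed.

Lemma recurrence_window_eq0 (K : pzRingType) (p N : nat)
    (b : nat -> nat -> K) (t : nat -> K) :
  (forall n, (N <= n)%N -> t (n + p)%N = \sum_(j < p) b n j * t (n + j)%N) ->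
  (forall j, (j < p)%N -> t (N + j)%N = 0) ->
  forall n, (N <= n)%N -> t n = 0.
Proof.
move=> rec init; elim/ltn_ind=> n IHn leNn.
have [lt_n|le_n] := ltnP n (N + p).
  by rewrite -(subnKC leNn) init //; lia.
have -> : n = (n - p + p)%N by lia.
rewrite rec; last by lia.
by rewrite big1 // => j _; rewrite IHn ?mulr0 //; have := ltn_ord j; lia.
Qed.

(** The relation is found on the window starting at [N], as a vector in the
    left kernel of a matrix with one more row than columns, and is then
    propagated to all later indices by the recurrence. *)
Lemma periodic_coefficients_relation (K : fieldType) (p N q : nat)
    (b : nat -> nat -> K) (s : nat -> K) :
  (forall n j, (N <= n)%N -> (j < p)%N -> b (n + q)%N j = b n j) ->
  (forall n, (N <= n)%N -> s (n + p)%N = \sum_(j < p) b n j * s (n + j)%N) ->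
  exists2 u : 'rV[K]_p.+1, u != 0 &
    forall n, (N <= n)%N -> \sum_k u 0 k * s (n + k * q)%N = 0.
Proof.
move=> per rec.
pose V := \matrix_(k < p.+1, j < p) s (N + j + k * q)%N.
have /rowV0Pn[u /sub_kermxP uV0 u_neq0] : kermx V != 0.
  by rewrite -mxrank_eq0 mxrank_ker subn_eq0 -ltnNge ltnS rank_leq_col.
exists u => //.
apply: (@recurrence_window_eq0 _ p N b) => [n leNn|j ltjp].
  under [RHS]eq_bigr do rewrite mulr_sumr.
  rewrite exchange_big; apply: eq_bigr => k _.
  rewrite addnAC rec; last by lia.
  rewrite mulr_sumr; apply: eq_bigr => j _.
  rewrite (@eventually_periodic_mul _ (fun n => b n j) N) //.
    by rewrite mulrCA addnAC.
  by move=> l leNl; apply: per.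
have := congr1 (fun M : 'rV_p => M 0 (Ordinal ltjp)) uV0.
by rewrite !mxE => uVj; rewrite -[RHS]uVj; apply: eq_bigr => k _; rewrite mxE.
Qed.

Lemma linear_recurrence_of_relation (K : fieldType) (l N q : nat)
    (u : 'I_l -> K) (k0 : 'I_l) (s : nat -> K) :
  (0 < q)%N -> u k0 != 0 ->
  (forall n, (N <= n)%N -> \sum_k u k * s (n + k * q)%N = 0) ->
  linear_recurrence s.
Proof.
move=> q_gt0 uk0 rel.
have [h uh hmax] := @arg_maxnP _ k0 (fun k => u k != 0) (fun k : 'I_l => k : nat) uk0.
(* An order exceeding [N + h * q] absorbs the range where the relation need
   not hold; the added coefficients are zero. *)
pose c (j : nat) := \sum_(k < l | (k < h)%N) (j == (h - k) * q)%N%:R * - (u k / u h).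
exists (N + h * q).+1, c; split=> // n ltn.
have {rel} := rel (n - h * q)%N ltac:(lia).
rewrite (bigID (fun k : 'I_l => (k < h)%N)) /= (bigD1 h (P := fun k : 'I_l => ~~ (k < h)%N)) ?ltnn //=.
rewrite [X in _ + (_ + X)]big1 ?addr0; last first.
  move=> k /andP[nltkh neqkh].
  have [->|/hmax le_kh] := eqVneq (u k) 0; first by rewrite mul0r.
  by case/eqP: neqkh; apply: val_inj => /=; lia.
rewrite subnK; last by lia.
move=> /eqP; rewrite addrC addr_eq0 => /eqP rel.
apply: (mulfI uh); rewrite rel mulr_sumr -sumrN.
under [RHS]eq_bigr do rewrite mulr_suml mulr_sumr.
rewrite exchange_big; apply: eq_bigr => k ltkh /=.
have lekh : ((h - k) * q <= h * q)%N by rewrite leq_mul2r leq_subr orbT.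
have gt0 : (0 < (h - k) * q)%N by rewrite muln_gt0 subn_gt0 ltkh.
rewrite (bigD1_seq ((h - k) * q)%N) ?iota_uniq ?mem_index_iota //=; last by lia.
rewrite eqxx mul1r big1 ?addr0 => [|j /negPf->]; last by rewrite !mul0r mulr0.
have -> : (n - (h - k) * q = n - h * q + k * q)%N.
  by move: lekh; rewrite mulnBl; have := leq_mul (ltnW ltkh) (leqnn q); lia.
by rewrite mulrA mulrN mulrCA mulfV // mulr1 mulNr.
Qed.

Lemma periodic_coefficients_linear_recurrence (K : fieldType) (p N q : nat)
    (b : nat -> nat -> K) (s : nat -> K) :
  (0 < q)%N ->
  (forall n j, (N <= n)%N -> (j < p)%N -> b (n + q)%N j = b n j) ->
  (forall n, (N <= n)%N -> s (n + p)%N = \sum_(j < p) b n j * s (n + j)%N) ->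
  linear_recurrence s.
Proof.
move=> q_gt0 per rec.
have [u /rV0Pn[k0 uk0] rel] := periodic_coefficients_relation _ _ _ _ _ _ per rec.
exact: (linear_recurrence_of_relation _ _ _ _ _ _ _ q_gt0 uk0 rel).
Qed.

Theorem theorem3p1 (R : realType) (m : nat) (alpha0 : nat -> R)
    (A : nat -> int -> int) :
  (1 <= m)%N ->
  (forall i : nat, (1 <= i <= m)%N -> irrational (alpha0 i)) ->
  jp_nonterminating m alpha0 ->
  jp_convergents m (jp_quotient m alpha0) A ->
  (forall i : nat, (1 <= i <= m)%N ->
     eventually_periodic (fun n : nat => jp_quotient m alpha0 n i)) ->
  forall i : nat, (1 <= i <= m.+1)%N ->
    linear_recurrence (fun n : nat => (A i n%:Z)%:~R : R[i]).
Proof.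
move=> _ _ _ conv per i hi.
have [N [q [q_gt0 perN]]] := common_period _ _ _ per.
(* In ascending order of the indices, the coefficient of [A_n] in the
   recurrence for [A_(n + m + 1)] is 1, and that of [A_(n + j)] is the
   partial quotient of upper index [m + 1 - j]. *)
pose b n j : R[i] :=
  if j is 0 then 1 else (jp_quotient m alpha0 (n + m.+1) (m.+1 - j))%:~R.
apply: (@periodic_coefficients_linear_recurrence _ m.+1 N q b) => //.
  by move=> n [|j] // leNn ltj; rewrite /b addnAC perN //; lia.
move=> n _; rewrite (jp_conv_rec conv) ?addnS // rmorphD rmorph_sum /=.
rewrite big_ord_recl /= mul1r addn0 addrC; congr (_%:~R + _).
  by congr (A i _); lia.
rewrite big_nat_rev big_add1 /= big_mkord; apply: eq_bigr => j _.
rewrite rmorphM /= addnS; congr (_%:~R * (A i _)%:~R).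
  by congr (jp_quotient _ _ _ _); rewrite /bump /=; lia.
by rewrite /bump /=; have := ltn_ord j; lia.
Qed.
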